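(* ESP-DAG with $k=2$ machines is linear-time (many-one) reducible to DM-$s$-$t$-Cut.
   Context: $[k]=\{1,\dots,k\}$. For a digraph $G$ and $v\in V(G)$, $N^+_G(v)=\{u : (v,u)\in A(G)\}$; for $S\subseteq V(G)$, $\mathbf{1}_G(v,S)=1$ if $N^+_G(v)\cap S\neq\emptyset$ and $0$ otherwise. For $f:V(G)\to[k]$ and $q:V(G)\to\mathbb{R}_{\geq 0}$, $\mathrm{tr}(f,q,G)=\sum_{i\in[k]}\sum_{v\in f^{-1}(i)}\sum_{j\in[k]\setminus\{i\}} q(v)\cdot \mathbf{1}_G(v,f^{-1}(j))$. ESP-DAG with $k$ machines: given a DAG $G$, $p:V(G)\times[k]\to\mathbb{R}_{\geq 0}$, $q:V(G)\to\mathbb{R}_{\geq 0}$ and a rational $r$, decide whether some $f:V(G)\to[k]$ satisfies $\sum_{v} p(v,f(v))+\mathrm{tr}(f,q,G)\leq r$. DM-$s$-$t$-Cut: given a digraph $G$, a weight function $w:A(G)\to\mathbb{R}_{\geq 0}$, two vertices $s,t\in V(G)$ and a number $r$, decide whether there is a bipartition $(V_s,V_t)$ of $V(G)$ with $s\in V_s$, $t\in V_t$ and $\sum_{(x,y)\in A(G),\,x\in V_s,\,y\in V_t} w((x,y))\leq r$. *)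

(* Defs.v *)
From HB Require Import structures.
From mathcomp Require Import all_boot all_order all_algebra.
From mathcomp Require Import reals.

Set Implicit Arguments.
Unset Strict Implicit.
Unset Printing Implicit Defensive.

Import Order.TTheory GRing.Theory Num.Theory.
Local Open Scope ring_scope.

(** * Digraphs

A digraph on the finite vertex set [V] is given by its arc set
[A : {set V * V}]; hence there are no parallel arcs. *)

Section Digraph.
Variables (V : finType) (A : {set V * V}).

Definition out_nbrs (v : V) : {set V} := [set u | (v, u) \in A].

Definition meets_out (v : V) (S : {set V}) : bool := out_nbrs v :&: S != set0.

(* [ucycle] is a closed walk without repeated vertex, so this says that there
   is no directed cycle, loops and 2-cycles included. *)
Definition acyclic : Prop :=
  forall c : seq V, ucycle (fun x y => (x, y) \in A) c -> c = [::].

Definition tr (R : realType) (k : nat) (f : V -> 'I_k) (q : V -> R) : R :=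
  \sum_(i < k) \sum_(v in f @^-1: [set i]) \sum_(j < k | j != i)
    q v * (meets_out v (f @^-1: [set j]))%:R.

(* The vertices are numbered by their positions in [vs]; the arcs are listed
   in the order of [es]. *)
Definition digraph_words (vs : seq V) (es : seq (V * V)) : seq nat :=
  size vs :: size es ::
  flatten [seq [:: index e.1 vs; index e.2 vs] | e <- es].

End Digraph.

(** * Decision problems

An instance is presented to a machine as a list of words and a list of reals.
The presentation is a relation: an instance may be written down in several
ways, according to the order in which vertices and arcs are listed. *)

Record problem (R : realType) := Problem {
  instance : Type;
  yes : instance -> Prop;
  encodes : instance -> seq nat -> seq R -> Prop
}.

(** ** ESP-DAG with [k] machines *)

Record esp_instance (R : realType) (k : nat) := EspInstance {
  esp_V : finType;
  esp_A : {set esp_V * esp_V};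
  esp_p : esp_V -> 'I_k -> R;
  esp_q : esp_V -> R;
  esp_r : rat;
  esp_dag : acyclic esp_A;
  esp_p_ge0 : forall v i, 0 <= esp_p v i;
  esp_q_ge0 : forall v, 0 <= esp_q v
}.

Definition esp_yes (R : realType) (k : nat) (I : esp_instance R k) : Prop :=
  exists f : esp_V I -> 'I_k,
    \sum_v esp_p v (f v) + tr (esp_A I) f (@esp_q R k I) <= ratr (esp_r I).

Definition esp_encodes (R : realType) (k : nat) (I : esp_instance R k)
    (ws : seq nat) (rs : seq R) : Prop :=
  exists (vs : seq (esp_V I)) (es : seq (esp_V I * esp_V I)),
    [/\ perm_eq vs (enum (esp_V I)),
        perm_eq es (enum (esp_A I)),
        ws = digraph_words vs es &
        rs = [seq esp_p v i | v <- vs, i <- enum 'I_k]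
               ++ [seq esp_q v | v <- vs] ++ [:: ratr (esp_r I)]].

Definition ESP_DAG (R : realType) (k : nat) : problem R :=
  Problem (@esp_yes R k) (@esp_encodes R k).

(** ** DM-s-t-Cut *)

(* Only the values of the weight function on arcs are meaningful. *)
Record cut_instance (R : realType) := CutInstance {
  cut_V : finType;
  cut_A : {set cut_V * cut_V};
  cut_w : cut_V * cut_V -> R;
  cut_s : cut_V;
  cut_t : cut_V;
  cut_r : R;
  cut_w_ge0 : forall e, e \in cut_A -> 0 <= cut_w e;
  cut_st : cut_s != cut_t
}.

Definition cut_yes (R : realType) (J : cut_instance R) : Prop :=
  exists Vs Vt : {set cut_V J},
    [/\ Vs :|: Vt = [set: cut_V J], [disjoint Vs & Vt],
        cut_s J \in Vs, cut_t J \in Vt &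
        \sum_(e in cut_A J | (e.1 \in Vs) && (e.2 \in Vt)) cut_w e <= cut_r J].

Definition cut_encodes (R : realType) (J : cut_instance R)
    (ws : seq nat) (rs : seq R) : Prop :=
  exists (vs : seq (cut_V J)) (es : seq (cut_V J * cut_V J)),
    [/\ perm_eq vs (enum (cut_V J)),
        perm_eq es (enum (cut_A J)),
        ws = digraph_words vs es ++ [:: index (cut_s J) vs; index (cut_t J) vs] &
        rs = [seq cut_w e | e <- es] ++ [:: cut_r J]].

Definition DM_st_Cut (R : realType) : problem R :=
  Problem (@cut_yes R) (@cut_encodes R).

(** * Real RAM

The unit-cost real RAM: a random access machine on words of [b] bits which
also has registers and a random access memory for exact real numbers. Word
arithmetic is modulo [2 ^ b]. Reals can be moved, compared and combined by
field operations; there is no rounding and no conversion to words. In the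
instructions, numbers [d], [i], [j] are register names and [l] is a position in
the program. *)

Inductive binop := Add | Sub | Mul | Div.

Inductive instr :=
| WConst of nat & nat            (* WConst d a    : X_d := a *)
| WMove of nat & nat             (* WMove d i     : X_d := X_i *)
| WOp of binop & nat & nat & nat (* WOp o d i j   : X_d := X_i o X_j *)
| WLoad of nat & nat             (* WLoad d i     : X_d := W[X_i] *)
| WStore of nat & nat            (* WStore i j    : W[X_i] := X_j *)
| RConst of nat & int            (* RConst d a    : Y_d := a *)
| RMove of nat & nat             (* RMove d i     : Y_d := Y_i *)
| ROp of binop & nat & nat & nat (* ROp o d i j   : Y_d := Y_i o Y_j *)
| RLoad of nat & nat             (* RLoad d i     : Y_d := M[X_i] *)
| RStore of nat & nat            (* RStore i j    : M[X_i] := Y_j *)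
| Jump of nat                    (* Jump l        : go to l *)
| WJumpEq of nat & nat & nat     (* WJumpEq i j l : if X_i = X_j go to l *)
| WJumpLt of nat & nat & nat     (* WJumpLt i j l : if X_i < X_j go to l *)
| RJumpEq of nat & nat & nat     (* RJumpEq i j l : if Y_i = Y_j go to l *)
| RJumpLt of nat & nat & nat     (* RJumpLt i j l : if Y_i < Y_j go to l *)
| Halt.

Section Machine.
Variable R : realType.

Record state := State {
  pc : nat;
  wreg : nat -> nat;
  rreg : nat -> R;
  wmem : nat -> nat;
  rmem : nat -> R
}.

Definition upd (T : Type) (g : nat -> T) (a : nat) (x : T) : nat -> T :=
  fun a' => if a' == a then x else g a'.

Definition wop (b : nat) (o : binop) (x y : nat) : nat :=
  match o with
  | Add => (x + y) %% 2 ^ b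
  | Sub => (x + (2 ^ b - y)) %% 2 ^ b
  | Mul => (x * y) %% 2 ^ b
  | Div => x %/ y
  end%N.

Definition rop (o : binop) (x y : R) : R :=
  match o with
  | Add => x + y
  | Sub => x - y
  | Mul => x * y
  | Div => x / y
  end.

(* Positions beyond the end of the program hold [Halt]. *)
Definition fetch (pr : seq instr) (st : state) : instr := nth Halt pr (pc st).

Definition halted (pr : seq instr) (st : state) : bool :=
  if fetch pr st is Halt then true else false.

(* A halted state is left unchanged. *)
Definition step (b : nat) (pr : seq instr) (st : state) : state :=
  let: State c X Y W M := st in
  match fetch pr st with
  | WConst d a => State c.+1 (upd X d (a %% 2 ^ b)%N) Y W M
  | WMove d i => State c.+1 (upd X d (X i)) Y W M
  | WOp o d i j => State c.+1 (upd X d (wop b o (X i) (X j))) Y W M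
  | WLoad d i => State c.+1 (upd X d (W (X i))) Y W M
  | WStore i j => State c.+1 X Y (upd W (X i) (X j)) M
  | RConst d a => State c.+1 X (upd Y d a%:~R) W M
  | RMove d i => State c.+1 X (upd Y d (Y i)) W M
  | ROp o d i j => State c.+1 X (upd Y d (rop o (Y i) (Y j))) W M
  | RLoad d i => State c.+1 X (upd Y d (M (X i))) W M
  | RStore i j => State c.+1 X Y W (upd M (X i) (Y j))
  | Jump l => State l X Y W M
  | WJumpEq i j l => State (if X i == X j then l else c.+1) X Y W M
  | WJumpLt i j l => State (if (X i < X j)%N then l else c.+1) X Y W M
  | RJumpEq i j l => State (if Y i == Y j then l else c.+1) X Y W M
  | RJumpLt i j l => State (if Y i < Y j then l else c.+1) X Y W M
  | Halt => st
  end.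

(* Calling convention, for input and output alike: the list of words occupies
   the cells [W[X_0], ..., W[X_0 + X_1 - 1]] and the list of reals occupies the
   cells [M[X_2], ..., M[X_2 + X_3 - 1]]. Initially [X_0 = X_2 = 0], and all
   other registers and cells hold 0. *)
Definition init (ws : seq nat) (rs : seq R) : state :=
  State 0 (nth 0%N [:: 0%N; size ws; 0%N; size rs]) (fun=> 0)
    (nth 0%N ws) (nth 0 rs).

Definition word_output (st : state) : seq nat :=
  mkseq (fun a => wmem st (wreg st 0 + a)%N) (wreg st 1).

Definition real_output (st : state) : seq R :=
  mkseq (fun a => rmem st (wreg st 2 + a)%N) (wreg st 3).

Definition computes_within (b : nat) (pr : seq instr) (time : nat)
    (ws : seq nat) (rs : seq R) (ws' : seq nat) (rs' : seq R) : Prop :=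
  let st := iter time (step b pr) (init ws rs) in
  [/\ halted pr st, word_output st = ws' & real_output st = rs'].

End Machine.

(** * Linear-time many-one reductions

The size of an input is its number of words and reals. The program is fixed
and has to work as soon as the word length [b] suffices to write numbers linear
in the input size, i.e. already for words of [log2 size + O(1)] bits; the output
does not depend on [b]. *)

Definition linear_time_reducible (R : realType) (P Q : problem R) : Prop :=
  exists (pr : seq instr) (c : nat),
  forall (I : instance P) (ws : seq nat) (rs : seq R),
    encodes I ws rs ->
    exists (J : instance Q) (ws' : seq nat) (rs' : seq R),
      [/\ encodes J ws' rs',
          yes I <-> yes J &
          forall b : nat, (c * (size ws + size rs) <= 2 ^ b)%N ->
            computes_within b pr (c * (size ws + size rs)) ws rs ws' rs'].

(* Main.v *)
(* Every vertex [v] becomes three vertices [v], [fan_out v], [fan_in v];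
   machine 1 is the source side. The arcs [src -> v] of weight [p v 2] and [v
   -> snk] of weight [p v 1] account for the execution cost. The arc [v ->
   fan_out v] and the arcs [fan_out v -> u], for [u] an out-neighbour of [v],
   all have weight [q v]: if [v] is on the source side and some [u] is not,
   then at least one of them is cut, and putting [fan_out v] on the sink side
   cuts only the first. The vertex [fan_in v] does the same when [v] is on the
   sink side, with reversed arcs. Hence the minimum cut extending a given
   assignment costs exactly as much as the assignment, without any arc of
   infinite weight. The cut graph has [3 n + 2] vertices and [4 n + 2 m] arcs,
   which one pass over the vertices and one pass over the arcs write out,
   right behind the input. *)

Require Import Defs.
From mathcomp Require Import all_boot all_order all_algebra.
From mathcomp Require Import boolp reals.
From mathcomp Require Import zify.

Set Implicit Arguments.
Unset Strict Implicit.
Unset Printing Implicit Defensive.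

(** * Lists: appending at the end, flattened blocks, positions *)

Lemma upd_nth (T : Type) (x0 : T) (s : seq T) (a : nat) (x : T) :
  upd (nth x0 s) a x = nth x0 (set_nth x0 s a x).
Proof. by apply: funext => a'; rewrite nth_set_nth. Qed.

Lemma set_nth_size (T : Type) (x0 : T) (s : seq T) (x : T) :
  set_nth x0 s (size s) x = rcons s x.
Proof. by rewrite set_nthE ltnn subnn cats1. Qed.

Lemma mkseq_nth_cat (T : Type) (x0 : T) (s s' : seq T) :
  mkseq (fun a => nth x0 (s ++ s') (size s + a)) (size s') = s'.
Proof.
rewrite -[RHS](mkseq_nth x0); apply: eq_mkseq => a.
by rewrite nth_cat ltnNge leq_addr addKn.
Qed.

Lemma size_flatten_map (S T : Type) (g : S -> seq T) (c : nat) (s : seq S) :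
  (forall x, size (g x) = c) -> size (flatten (map g s)) = (c * size s)%N.
Proof.
move=> sz_g; elim: s => [|x s IHs] /=; first by rewrite muln0.
by rewrite size_cat IHs sz_g mulnS.
Qed.

(** The function [owner] recovers from an entry the block containing it, so different blocks share
    no entry. *)
Lemma uniq_flatten_map (S T : eqType) (g : S -> seq T) (owner : T -> option S)
    (s : seq S) :
    uniq s -> (forall x, uniq (g x)) ->
    (forall x y, y \in g x -> owner y = Some x) ->
  uniq (flatten (map g s)).
Proof.
move=> uniq_s uniq_g ownerP; elim: s uniq_s => //= x s IHs /andP[x_s uniq_s].
rewrite cat_uniq uniq_g IHs // andbT; apply/hasPn => y.
move=> /flattenP[_ /mapP[z z_s ->]] /ownerP y_z; apply: contra x_s => /ownerP.
by rewrite y_z => -[<-].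
Qed.

Lemma mem_map_notin (S T : eqType) (g : S -> T) (s : seq S) (y : T) :
  (forall x, g x != y) -> (y \in map g s) = false.
Proof.
by move=> gy; apply/mapP => -[x _ yE]; move: (gy x); rewrite yE eqxx.
Qed.

Lemma map_index (T : eqType) (s : seq T) :
  uniq s -> [seq index x s | x <- s] = iota 0 (size s).
Proof.
case: s => // x0 s uniq_s; apply: (@eq_from_nth _ 0%N).
  by rewrite size_map size_iota.
move=> i; rewrite size_map => lt_i.
by rewrite (nth_map x0) // index_uniq // nth_iota.
Qed.

Lemma map_flatten_map (S T U : Type) (h : T -> U) (g : S -> seq T) (s : seq S) :
  map h (flatten (map g s)) = flatten [seq map h (g x) | x <- s].
Proof. by rewrite map_flatten -map_comp. Qed.

Lemma flatten_flatten (T : Type) (sss : seq (seq (seq T))) :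
  flatten (flatten sss) = flatten (map flatten sss).
Proof. by elim: sss => //= ss sss <-; rewrite flatten_cat. Qed.

Lemma nth_flatten_pairs (S T : eqType) (F G : S -> T) (s : seq S) (s' : seq T)
    (x0 : T) (v : S) : v \in s ->
  let t := flatten [seq [:: F v; G v] | v <- s] ++ s' in
  nth x0 t (2 * index v s) = F v /\ nth x0 t (2 * index v s).+1 = G v.
Proof.
elim: s => // u s IHs; rewrite inE eq_sym [index _ _]/=.
by case: eqP => [->|_] // v_s; rewrite mulnS; exact: IHs v_s.
Qed.

Lemma sum_flatten_map (R : nmodType) (S T : Type) (g : S -> seq T) (s : seq S)
    (F : T -> R) :
  (\sum_(y <- flatten (map g s)) F y = \sum_(x <- s) \sum_(y <- g x) F y)%R.
Proof.
elim: s => [|x s IHs] /=; first by rewrite !big_nil.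
by rewrite big_cat big_cons IHs.
Qed.

(** * The program of the reduction *)

Local Arguments wop : simpl never.
Local Arguments iter : simpl never.

(* Register conventions of the program: [X_0], [X_2] are the ends of the input
   and [X_1], [X_3] the ends of the words and reals written so far; [X_4 = 1],
   [X_5 = n], [X_6 = m], [X_7 = 2 n], [X_8 = 3 n] and [X_9 = 3 n + 1]. In the
   cut graph [v], [fan_out v] and [fan_in v] have numbers [v], [n + v] and [2
   n + v], and [src], [snk] have numbers [X_8], [X_9]. In the real input, [p]
   fills the first [2 n] cells, so [q v] is in cell [2 n + v] and [r] in cell
   [3 n]. *)
Definition push_word (j : nat) : seq instr := [:: WStore 1 j; WOp Add 1 1 4].

Definition push_real (j : nat) : seq instr := [:: RStore 3 j; WOp Add 3 3 4].

Definition push_arc (i j y : nat) : seq instr :=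
  push_word i ++ push_word j ++ push_real y.

Definition reduction_prog : seq instr :=
  [:: WMove 0 1; WMove 2 3; WConst 4 1; WLoad 5 10; WLoad 6 4;
      WOp Add 7 5 5; WOp Add 8 7 5; WOp Add 9 8 4; WOp Add 13 9 4]
  ++ push_word 13
  ++ [:: WOp Add 13 7 6; WOp Add 13 13 13]
  ++ push_word 13
  ++ [:: WMove 11 5; WMove 12 7]
  ++ (* 17: loop over the vertices, [X_10] = [v] *)
  [:: WJumpEq 10 5 51; RLoad 0 14; WOp Add 14 14 4; RLoad 1 14;
      WOp Add 14 14 4; RLoad 2 12]
  ++ push_arc 8 10 1 ++ push_arc 10 9 0
  ++ push_arc 10 11 2 ++ push_arc 12 10 2
  ++ [:: WOp Add 10 10 4; WOp Add 11 11 4; WOp Add 12 12 4; Jump 17]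
  ++ (* 51: loop over the arcs, [X_10] = read position; the body starts at 52 *)
  [:: WConst 10 2;
      WJumpEq 10 0 73; WLoad 11 10; WOp Add 10 10 4; WLoad 12 10;
      WOp Add 10 10 4; WOp Add 13 7 11; RLoad 0 13; WOp Add 14 5 11]
  ++ push_arc 14 12 0 ++ push_arc 12 13 0
  ++ [:: Jump 52]
  ++ (* 73: the numbers of [src] and [snk], the bound [r], the lengths *)
  push_word 8 ++ push_word 9 ++ [:: RLoad 0 8] ++ push_real 0
  ++ [:: WOp Defs.Sub 1 1 0; WOp Defs.Sub 3 3 2].

(** * Symbolic execution of the program *)

Section Run.
Variables (R : realType) (b : nat).
Local Notation word_lt x := (x < 2 ^ b)%N.

Lemma wop_add (x y : nat) : word_lt (x + y) -> wop b Add x y = (x + y)%N.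
Proof. by move=> lt_xy; rewrite /wop modn_small. Qed.

Lemma wop_sub (x y : nat) :
  (y <= x)%N -> word_lt x -> wop b Defs.Sub x y = (x - y)%N.
Proof.
move=> le_yx lt_x; rewrite /wop addnBA.
  rewrite addnC -addnBA // modnDl modn_small //.
  exact: leq_ltn_trans (leq_subr _ _) lt_x.
exact: ltnW (leq_ltn_trans le_yx lt_x).
Qed.

(* The memory is the list written so far, padded with zeros, so that storing
   at its end amounts to [rcons]. *)
Definition conf (c : nat) (xs : seq nat) (ys : seq R) (ws : seq nat)
    (rs : seq R) : state R :=
  State c (nth 0%N xs) (nth 0%R ys) (nth 0%N ws) (nth 0%R rs).

(** Mirrors [step] on padded lists, so that a run from explicitly listed registers is evaluated by
    simplification rather than through nested [upd]. *)
Definition exec (i : instr) (c : nat) (xs : seq nat) (ys : seq R)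
    (ws : seq nat) (rs : seq R) : state R :=
  let X := nth 0%N xs in
  let Y := nth 0%R ys in
  match i with
  | WConst d a => conf c.+1 (set_nth 0%N xs d (a %% 2 ^ b)%N) ys ws rs
  | WMove d i => conf c.+1 (set_nth 0%N xs d (X i)) ys ws rs
  | WOp o d i j => conf c.+1 (set_nth 0%N xs d (wop b o (X i) (X j))) ys ws rs
  | WLoad d i => conf c.+1 (set_nth 0%N xs d (nth 0%N ws (X i))) ys ws rs
  | WStore i j => conf c.+1 xs ys (set_nth 0%N ws (X i) (X j)) rs
  | RConst d a => conf c.+1 xs (set_nth 0%R ys d a%:~R%R) ws rs
  | RMove d i => conf c.+1 xs (set_nth 0%R ys d (Y i)) ws rs
  | ROp o d i j => conf c.+1 xs (set_nth 0%R ys d (rop o (Y i) (Y j))) ws rs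
  | RLoad d i => conf c.+1 xs (set_nth 0%R ys d (nth 0%R rs (X i))) ws rs
  | RStore i j => conf c.+1 xs ys ws (set_nth 0%R rs (X i) (Y j))
  | Jump l => conf l xs ys ws rs
  | WJumpEq i j l => conf (if X i == X j then l else c.+1) xs ys ws rs
  | WJumpLt i j l => conf (if (X i < X j)%N then l else c.+1) xs ys ws rs
  | RJumpEq i j l => conf (if Y i == Y j then l else c.+1) xs ys ws rs
  | RJumpLt i j l => conf (if (Y i < Y j)%R then l else c.+1) xs ys ws rs
  | Halt => conf c xs ys ws rs
  end.

Lemma iter_step k (pr : seq instr) c xs ys ws rs :
  iter k.+1 (step b pr) (conf c xs ys ws rs) =
  iter k (step b pr) (exec (nth Halt pr c) c xs ys ws rs).
Proof.
rewrite iterSr; congr iter; rewrite /step /conf /fetch /=.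
by case: (nth Halt pr c) => //= *; rewrite upd_nth.
Qed.

Lemma iter_push_word k pr c j xs ys ws rs :
    nth Halt pr c = WStore 1 j -> nth Halt pr c.+1 = WOp Add 1 1 4 ->
    nth 0%N xs 1 = size ws -> nth 0%N xs 4 = 1%N -> word_lt (size ws).+1 ->
  iter k.+2 (step b pr) (conf c xs ys ws rs) =
  iter k (step b pr)
    (conf c.+2 (set_nth 0%N xs 1 (size (rcons ws (nth 0%N xs j)))) ys
       (rcons ws (nth 0%N xs j)) rs).
Proof.
move=> prc prSc xs1 xs4 lt_ws; rewrite iter_step prc /= iter_step prSc /=.
by rewrite xs1 xs4 wop_add addn1 // set_nth_size size_rcons.
Qed.

Lemma iter_push_real k pr c j xs ys ws rs :
    nth Halt pr c = RStore 3 j -> nth Halt pr c.+1 = WOp Add 3 3 4 ->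
    nth 0%N xs 3 = size rs -> nth 0%N xs 4 = 1%N -> word_lt (size rs).+1 ->
  iter k.+2 (step b pr) (conf c xs ys ws rs) =
  iter k (step b pr)
    (conf c.+2 (set_nth 0%N xs 3 (size (rcons rs (nth 0%R ys j)))) ys ws
       (rcons rs (nth 0%R ys j))).
Proof.
move=> prc prSc xs3 xs4 lt_rs; rewrite iter_step prc /= iter_step prSc /=.
by rewrite xs3 xs4 wop_add addn1 // set_nth_size size_rcons.
Qed.

Lemma iter_push_arc k pr c i j y xs ys ws rs :
    (forall l, (l < 6)%N ->
      nth Halt pr (c + l) = nth Halt (push_arc i j y) l) ->
    i != 1%N -> j != 1%N -> (4 < size xs)%N ->
    nth 0%N xs 1 = size ws -> nth 0%N xs 3 = size rs -> nth 0%N xs 4 = 1%N ->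
    word_lt (size ws).+2 -> word_lt (size rs).+1 ->
  let ws' := ws ++ [:: nth 0%N xs i; nth 0%N xs j] in
  let rs' := rs ++ [:: nth 0%R ys y] in
  iter k.+2.+2.+2 (step b pr) (conf c xs ys ws rs) =
  iter k (step b pr)
    (conf c.+2.+2.+2 (set_nth 0%N (set_nth 0%N xs 1 (size ws')) 3 (size rs')) ys
     ws' rs').
Proof.
(* Once five registers are exposed, the updates of [X_1] and [X_3] compute, whatever registers
   follow. *)
move=> prE i1 j1; case: xs => [|x0 [|x1 [|x2 [|x3 [|x4 xs]]]]] //= _ -> -> ->.
move=> lt_ws lt_rs.
have prE' l : (l < 6)%N -> nth Halt pr (l + c) = nth Halt (push_arc i j y) l.
  by rewrite addnC; apply: prE.
rewrite (@iter_push_word _ _ _ i) ?(prE' 0) ?(prE' 1) //=; last exact: ltnW.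
rewrite (@iter_push_word _ _ _ j) ?(prE' 2) ?(prE' 3) //= ?size_rcons //.
rewrite (@iter_push_real _ _ _ y) ?(prE' 4) ?(prE' 5) //=.
rewrite -!cats1 -catA !size_cat /= addn1 addn2.
by move: i1 j1 prE prE'; case: i => [|[|i]] //; case: j => [|[|j]].
Qed.

Local Ltac run_step :=
  rewrite iter_step;
  match goal with |- context [exec (nth Halt reduction_prog ?c)] =>
    let i := eval vm_compute in (nth Halt reduction_prog c) in
    change (nth Halt reduction_prog c) with i
  end; rewrite /exec /=.

Local Ltac run_arc i j y :=
  rewrite (@iter_push_arc _ _ _ i j y) //;
  [rewrite /= | by move=> [|[|[|[|[|[|]]]]]] | rewrite /= ?size_cat /=; lia
              | rewrite /= ?size_cat /=; lia].

(** The 34 steps are 6 to test and load, four arc pushes of 6 each, and 4 to advance and jump. All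
    reals are read before the first push. Register [X_12] (here [k]) has two roles: it is the number
    of [fan_in v] and also the cell of [q v]. *)
Lemma iter_vertex_pass fuel (ow : seq nat) (or : seq R)
    (s t n m n2 i j k x p ws0 rs0 : nat) (y0 y1 y2 : R) :
    i != n -> (p.+1 < size or)%N ->
    word_lt (size ow + 8) -> word_lt (size or + 4) ->
    word_lt i.+1 -> word_lt j.+1 -> word_lt k.+1 ->
  let ow' := ow ++ [:: s; i; i; t; i; j; k; i] in
  let or' := or ++ [:: nth 0%R or p.+1; nth 0%R or p; nth 0%R or k;
                       nth 0%R or k] in
  iter (34 + fuel) (step b reduction_prog)
    (conf 17 [:: ws0; size ow; rs0; size or; 1; n; m; n2; s; t; i; j; k; x; p]
       [:: y0; y1; y2] ow or) =
  iter fuel (step b reduction_prog)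
    (conf 17
       [:: ws0; size ow'; rs0; size or'; 1; n; m; n2; s; t; i.+1; j.+1; k.+1;
           x; p.+2]
       [:: nth 0%R or p; nth 0%R or p.+1; nth 0%R or k] ow' or').
Proof.
move=> neq_in lt_p lt_ow lt_or lt_i lt_j lt_k; rewrite !addSn add0n.
run_step; rewrite (negPf neq_in).
run_step; run_step; rewrite wop_add ?addn1; last by lia.
run_step; run_step; rewrite wop_add ?addn1; last by lia.
run_step.
run_arc 8 10 1; run_arc 10 9 0; run_arc 10 11 2; run_arc 12 10 2.
do 3 (run_step; rewrite wop_add ?addn1 //).
by run_step; rewrite -!catA.
Qed.

(** The 21 steps are 8 to test and load, two arc pushes of 6 each, and a jump. Here [X_13] is both
    the number of [fan_in u] and the cell of [q u], where [u] is the tail. *)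
Lemma iter_arc_pass fuel (ow : seq nat) (or : seq R)
    (s t n m n2 i j k u v x p ws0 rs0 : nat) (y0 y1 y2 : R) :
    i != ws0 -> nth 0%N ow i = u -> nth 0%N ow i.+1 = v ->
    word_lt (size ow + 4) -> word_lt (size or + 2) ->
    word_lt i.+2 -> word_lt (n + u) -> word_lt (n2 + u) ->
  let ow' := ow ++ [:: n + u; v; v; n2 + u]%N in
  let or' := or ++ [:: nth 0%R or (n2 + u); nth 0%R or (n2 + u)] in
  iter (21 + fuel) (step b reduction_prog)
    (conf 52 [:: ws0; size ow; rs0; size or; 1; n; m; n2; s; t; i; j; k; x; p]
       [:: y0; y1; y2] ow or) =
  iter fuel (step b reduction_prog)
    (conf 52
       [:: ws0; size ow'; rs0; size or'; 1; n; m; n2; s; t; i.+2; u; v;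
           (n2 + u)%N; (n + u)%N]
       [:: nth 0%R or (n2 + u); y1; y2] ow' or').
Proof.
move=> neq_i ow_i ow_Si lt_ow lt_or lt_i lt_nu lt_n2u; rewrite !addSn add0n.
run_step; rewrite (negPf neq_i).
run_step; rewrite ow_i.
run_step; rewrite wop_add ?addn1; last by lia.
run_step; rewrite ow_Si.
run_step; rewrite wop_add ?addn1; last by lia.
run_step; rewrite wop_add //.
run_step.
run_step; rewrite wop_add //.
run_arc 14 12 0; run_arc 12 13 0.
by run_step; rewrite -!catA.
Qed.

(** * Closed forms of the two loops *)

Definition vertex_words (n i : nat) : seq nat :=
  [:: 3 * n; i; i; 3 * n + 1; i; n + i; 2 * n + i; i]%N.

Definition vertex_reals (rs : seq R) (n i : nat) : seq R :=
  [:: nth 0%R rs (2 * i).+1; nth 0%R rs (2 * i); nth 0%R rs (2 * n + i);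
      nth 0%R rs (2 * n + i)].

Definition arc_words (n : nat) (e : nat * nat) : seq nat :=
  [:: n + e.1; e.2; e.2; 2 * n + e.1]%N.

Definition arc_reals (rs : seq R) (n : nat) (e : nat * nat) : seq R :=
  nseq 2 (nth 0%R rs (2 * n + e.1)).

(** Induction on the number [l] of iterations left. The real memory is kept split into the input
    [rs] and the output [or], since every read has to hit the input. *)
Lemma iter_vertex_loop fuel l i n m (ow : seq nat) (or rs : seq R)
    (x ws0 rs0 : nat) (y0 y1 y2 : R) :
    (i + l)%N = n -> (3 * n < size rs)%N ->
    word_lt (size ow + 8 * l) -> word_lt (size rs + size or + 4 * l) ->
  exists z0 z1 z2,
  let ow' := ow ++ flatten [seq vertex_words n i | i <- iota i l] in
  let or' := or ++ flatten [seq vertex_reals rs n i | i <- iota i l] in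
  iter (34 * l + fuel) (step b reduction_prog)
    (conf 17 [:: ws0; size ow; rs0; size (rs ++ or); 1; n; m; 2 * n; 3 * n;
                 3 * n + 1; i; n + i; 2 * n + i; x; 2 * i]%N
       [:: y0; y1; y2] ow (rs ++ or)) =
  iter fuel (step b reduction_prog)
    (conf 17 [:: ws0; size ow'; rs0; size (rs ++ or'); 1; n; m; 2 * n; 3 * n;
                 3 * n + 1; n; n + n; 2 * n + n; x; 2 * n]%N
       [:: z0; z1; z2] ow' (rs ++ or')).
Proof.
elim: l i ow or y0 y1 y2 => [|l IHl] i ow or y0 y1 y2 il lt_n lt_ow lt_or.
  by exists y0, y1, y2; rewrite /= !cats0 muln0 add0n -il addn0.
rewrite mulnS -addnA iter_vertex_pass ?size_cat //=; try by lia.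
have [||||z0 [z1 [z2 Ez]]] := IHl i.+1 (ow ++ vertex_words n i)
  (or ++ vertex_reals rs n i) (nth 0%R rs (2 * i)) (nth 0%R rs (2 * i).+1)
  (nth 0%R rs (2 * n + i)); rewrite ?size_cat /=; try by lia.
exists z0, z1, z2.
have Sp : (2 * i.+1 = (2 * i).+2)%N by rewrite mulnS.
move: Ez; rewrite Sp (addnS n) (addnS (2 * n)) -!catA /= !size_cat /= => <-.
(* The cells read, [2 * i], [2 * i + 1] and [2 * n + i], lie below [3 * n], hence in [rs]. *)
by rewrite !nth_cat !ifT ?addnA; try by lia.
Qed.

(** The list [pre] is the input already consumed, whose length is the read position [X_10]; each
    iteration moves one pair from [es] to the end of [pre]. *)
Lemma iter_arc_loop fuel es n m (pre ow : seq nat) (or rs : seq R)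
    (j k x p rs0 : nat) (y0 y1 y2 : R) :
    all (fun e => e.1 < n)%N es -> (3 * n < size rs)%N ->
  let ws := pre ++ flatten [seq [:: e.1; e.2] | e <- es] in
    word_lt (size ws + size ow + 4 * size es) ->
    word_lt (size rs + size or + 2 * size es) ->
  exists j' k' x' p' z0,
  let ow' := ow ++ flatten [seq arc_words n e | e <- es] in
  let or' := or ++ flatten [seq arc_reals rs n e | e <- es] in
  iter (21 * size es + fuel) (step b reduction_prog)
    (conf 52 [:: size ws; size (ws ++ ow); rs0; size (rs ++ or); 1; n; m; 2 * n;
                 3 * n; 3 * n + 1; size pre; j; k; x; p]%N
       [:: y0; y1; y2] (ws ++ ow) (rs ++ or)) =
  iter fuel (step b reduction_prog)
    (conf 52 [:: size ws; size (ws ++ ow'); rs0; size (rs ++ or'); 1; n; m;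
                 2 * n; 3 * n; 3 * n + 1; size ws; j'; k'; x'; p']%N
       [:: z0; y1; y2] (ws ++ ow') (rs ++ or')).
Proof.
elim: es pre ow or j k x p y0 => [|[u v] es IHes] pre ow or j k x p y0 /=.
  by move=> *; exists j, k, x, p, y0; rewrite !cats0 muln0 add0n.
move=> /andP[lt_u lt_es] lt_n lt_ow lt_or.
have size_fl : size (flatten [seq [:: e.1; e.2] | e <- es]) = (2 * size es)%N.
  exact: size_flatten_map.
have size_ws : (size (pre ++ [:: u, v & flatten [seq [:: e.1; e.2] | e <- es]])
  = size pre + (2 * size es).+2)%N.
  by rewrite size_cat /= size_fl.
move: lt_ow; rewrite size_ws => lt_ow.
rewrite mulnS -addnA (@iter_arc_pass _ _ _ _ _ _ _ _ _ _ _ u v);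
  rewrite ?size_cat ?size_ws /= ?size_fl //; try by lia.
- have := IHes (pre ++ [:: u; v]) (ow ++ arc_words n (u, v))
    (or ++ arc_reals rs n (u, v)) u v (2 * n + u)%N (n + u)%N
    (nth 0%R rs (2 * n + u)) lt_es lt_n.
  rewrite -!catA /= size_ws !size_cat /= ?size_fl.
  case=> [||j' [k' [x' [p' [z0 Ez]]]]]; try by lia.
  exists j', k', x', p', z0; move: Ez; rewrite -?catA /= addn2 => <-.
  by rewrite !nth_cat !ifT ?addnA ?addn2 ?addnS; try by lia.
- by rewrite -catA nth_cat ltnn subnn.
- by rewrite -catA nth_cat ltnNge leqnSn subSnn.
Qed.

(** * The complete run *)

Definition input_words (n : nat) (es : seq (nat * nat)) : seq nat :=
  n :: size es :: flatten [seq [:: e.1; e.2] | e <- es].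

Definition output_words (n : nat) (es : seq (nat * nat)) : seq nat :=
  (3 * n + 2)%N :: (4 * n + 2 * size es)%N ::
  flatten [seq vertex_words n i | i <- iota 0 n] ++
  flatten [seq arc_words n e | e <- es] ++ [:: 3 * n; 3 * n + 1]%N.

Definition output_reals (rs : seq R) (n : nat) (es : seq (nat * nat)) :
    seq R :=
  flatten [seq vertex_reals rs n i | i <- iota 0 n] ++
  flatten [seq arc_reals rs n e | e <- es] ++ [:: nth 0%R rs (3 * n)].

Lemma iter_halted k (pr : seq instr) c xs ys ws rs :
  nth Halt pr c = Halt ->
  iter k (step b pr) (conf c xs ys ws rs) = conf c xs ys ws rs.
Proof. by move=> halt; elim: k => // k IHk; rewrite iter_step halt. Qed.

Lemma init_conf ws (rs : seq R) :
  init ws rs =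
  conf 0 [:: 0; size ws; 0; size rs; 0; 0; 0; 0; 0; 0; 0; 0; 0; 0; 0]%N
    [:: 0; 0; 0]%R ws rs.
Proof.
rewrite /init /conf; congr State; apply: funext => a.
  by do 15 ?[case: a => [|a] //=]; rewrite !nth_nil.
by do 3 ?[case: a => [|a] //=]; rewrite nth_nil.
Qed.

Lemma reduction_prog_computes n es (rs : seq R) :
    all (fun e => e.1 < n)%N es -> size rs = (3 * n + 1)%N ->
  let ws := input_words n es in
  let time := (40 * (size ws + size rs))%N in
    (time <= 2 ^ b)%N ->
  computes_within b reduction_prog time ws rs (output_words n es)
    (output_reals rs n es).
Proof.
move=> lt_es sz_rs ws time.
set m := size es.
have sz_ws : size ws = (2 * m + 2)%N.
  by rewrite /= (@size_flatten_map _ _ _ 2) // addn2.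
have ws_0 : nth 0%N ws 0 = n by [].
have ws_1 : nth 0%N ws 1 = m by [].
(* Set-up takes 17 steps, each vertex 34, the passage between the loops 2, each arc 21, and the end
   10. The rest of the budget is spent in [Halt]. *)
have [fuel Etime] : exists fuel, time =
    (17 + (34 * n + (2 + (21 * m + (10 + fuel)))))%N.
  by exists (time - (29 + 34 * n + 21 * m))%N; rewrite /time; lia.
move=> le_time.
(* This bounds every number the run computes, in particular the ends of both memories, so no word
   operation wraps around. *)
have lt_b : word_lt (16 * (n + m + 1)).
  by apply: leq_trans le_time; rewrite /time; lia.
rewrite /computes_within init_conf Etime.
(* Position 82 is just past the program, where [Halt] is implicit. The output begins where the input
   ends, so [X_0] and [X_2] have to hold the input sizes. *)
suff [xs [ys [-> [xs0 [xs1 [xs2 xs3]]]]]] : exists xs ys,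
    iter (17 + (34 * n + (2 + (21 * m + (10 + fuel))))) (step b reduction_prog)
      (conf 0 [:: 0; size ws; 0; size rs; 0; 0; 0; 0; 0; 0; 0; 0; 0; 0; 0]%N
         [:: 0; 0; 0]%R ws rs) =
      conf 82 xs ys (ws ++ output_words n es) (rs ++ output_reals rs n es) /\
    nth 0%N xs 0 = size ws /\ nth 0%N xs 1 = size (output_words n es) /\
    nth 0%N xs 2 = size rs /\ nth 0%N xs 3 = size (output_reals rs n es).
  rewrite /halted /word_output /real_output /= xs0 xs1 xs2 xs3.
  by rewrite !mkseq_nth_cat.
have sz_vw l : size (flatten [seq vertex_words n i | i <- l]) = (8 * size l)%N.
  exact: size_flatten_map.
have sz_vr l :
    size (flatten [seq vertex_reals rs n i | i <- l]) = (4 * size l)%N.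
  exact: size_flatten_map.
have sz_aw : size (flatten [seq arc_words n e | e <- es]) = (4 * m)%N.
  exact: size_flatten_map.
have sz_ar : size (flatten [seq arc_reals rs n e | e <- es]) = (2 * m)%N.
  exact: size_flatten_map.
have ws_cat : ws = [:: n; m] ++ flatten [seq [:: e.1; e.2] | e <- es] by [].
(* Making [ws] opaque keeps simplification from unfolding it during the run. *)
move: ws sz_ws ws_0 ws_1 ws_cat @time Etime le_time => ws.
move=> sz_ws ws_0 ws_1 ws_cat time Etime le_time.
rewrite !(addSn _ (34 * n + _)) add0n.
do 3 run_step; rewrite modn_small; last by lia.
(* [X_10] is still 0 and [X_4] is 1, so they serve as the addresses of [n] and [m]. *)
run_step; rewrite ws_0; run_step; rewrite ws_1.
do 4 (run_step; rewrite wop_add; last by lia).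
rewrite (@iter_push_word _ _ _ 13) //; last by lia.
rewrite [set_nth _ _ _ _]/=.
run_step; rewrite wop_add; last by lia.
run_step; rewrite wop_add; last by lia.
rewrite (@iter_push_word _ _ _ 13) //; last by rewrite size_rcons; lia.
do 2 run_step.
have [-> -> -> ->] : [/\ (n + n = 2 * n)%N, (2 * n + n = 3 * n)%N,
    (3 * n + 1 + 1 = 3 * n + 2)%N &
    (2 * n + m + (2 * n + m) = 4 * n + 2 * m)%N].
  by split; lia.
rewrite -!cats1 -catA /=; set hd := [:: (3 * n + 2)%N; _].
set vw := flatten [seq vertex_words n i | i <- iota 0 n].
set vr := flatten [seq vertex_reals rs n i | i <- iota 0 n].
set aw := flatten [seq arc_words n e | e <- es].
set ar := flatten [seq arc_reals rs n e | e <- es].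
have [sz_vwn sz_vrn] : size vw = (8 * n)%N /\ size vr = (4 * n)%N.
  by rewrite sz_vw sz_vr size_iota.
have [||||z0 [z1 [z2]]] :=
  @iter_vertex_loop (2 + (21 * m + (10 + fuel))) n 0 n m (ws ++ hd) [::] rs
    (4 * n + 2 * m) (size ws) (size rs) 0%R 0%R 0%R;
  rewrite ?size_cat ?sz_ws /= ?sz_rs //; try by lia.
rewrite -/vw -/vr cats0 !addn0 muln0 => ->.
rewrite (addSn 1) add1n; run_step; rewrite eqxx.
run_step; rewrite modn_small; last by lia.
have := @iter_arc_loop (10 + fuel) es n m [:: n; m] (hd ++ vw) vr rs (n + n)
  (2 * n + n) (4 * n + 2 * m) (2 * n) (size rs) z0 z1 z2 lt_es.
cbv zeta; rewrite -ws_cat -/aw -/ar !catA sz_rs !size_cat sz_ws sz_vwn.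
rewrite sz_vrn /=.
case=> [|||j' [k' [x' [p' [z0' ->]]]]]; try by lia.
rewrite !(addSn _ fuel) add0n.
run_step; rewrite eqxx.
rewrite (@iter_push_word _ _ _ 8) //=; last first.
- by rewrite !size_cat sz_aw sz_vwn sz_ws /=; lia.
- by rewrite !size_cat sz_aw sz_vwn sz_ws /=; lia.
rewrite (@iter_push_word _ _ _ 9) //=; last first.
- by rewrite !size_rcons !size_cat sz_aw sz_vwn sz_ws /=; lia.
run_step.
rewrite (@iter_push_real _ _ _ 0) //=; last first.
- by rewrite !size_cat sz_ar sz_vrn sz_rs; lia.
- by rewrite !size_cat sz_ar sz_vrn sz_rs; lia.
rewrite !size_rcons !size_cat sz_aw sz_ar sz_vwn sz_vrn sz_ws sz_rs /=.
do 2 (run_step; rewrite wop_sub; [|by lia|by lia]).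
rewrite iter_halted //.
have r_n : nth 0%R (rs ++ vr ++ ar) (3 * n) = nth 0%R rs (3 * n).
  by rewrite nth_cat ifT ?sz_rs //; lia.
rewrite -!cats1 -!catA r_n.
rewrite /output_words /output_reals -/vw -/vr -/aw -/ar -/hd.
do 2 eexists; split; first reflexivity.
by do 3?split; rewrite /= ?size_cat ?sz_vwn ?sz_vrn ?sz_aw ?sz_ar /=; lia.
Qed.

End Run.

Import Order.TTheory GRing.Theory Num.Theory.
Local Open Scope ring_scope.

(** * The cut graph and the numbering of its vertices *)

Section CutGraph.
Variable V : finType.
Local Notation node := (V + V + V + bool)%type.

Definition vert (v : V) : node := inl (inl (inl v)).
Definition fan_out (v : V) : node := inl (inl (inr v)).
Definition fan_in (v : V) : node := inl (inr v).
(** The Boolean tells the side of the terminal, [true] being the source side. *)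
Definition src : node := inr true.
Definition snk : node := inr false.

(** This order yields the vertex numbers that the program uses. *)
Definition cut_vertices (vs : seq V) : seq node :=
  map vert vs ++ map fan_out vs ++ map fan_in vs ++ [:: src; snk].

Definition vertex_arcs (v : V) : seq (node * node) :=
  [:: (src, vert v); (vert v, snk); (vert v, fan_out v); (fan_in v, vert v)].

Definition link_arcs (e : V * V) : seq (node * node) :=
  [:: (fan_out e.1, vert e.2); (vert e.2, fan_in e.1)].

Definition cut_arcs (vs : seq V) (es : seq (V * V)) : seq (node * node) :=
  flatten (map vertex_arcs vs) ++ flatten (map link_arcs es).

(** The constructors at the two ends of an arc reveal what it was made from: a vertex arc joins [v]
    to its fans in the direction opposite to link arcs. Uniqueness lets sums over the arc set be
    taken over the list. *)
Lemma uniq_cut_arcs (vs : seq V) (es : seq (V * V)) :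
  uniq vs -> uniq es -> uniq (cut_arcs vs es).
Proof.
move=> uniq_vs uniq_es; rewrite cat_uniq; apply/and3P; split.
- apply: (@uniq_flatten_map _ _ _ (fun e => match e with
    | (inr _, inl (inl (inl v))) | (inl (inl (inl v)), _)
    | (inl (inr v), _) => Some v
    | _ => None end)) => //; first by move=> v; rewrite /= !inE /eq_op /= eqxx.
  move=> v e.
  by rewrite /vertex_arcs !inE => /or4P[] /eqP ->.
- apply/hasPn => y /flattenP[_ /mapP[e _ ->]]; rewrite /link_arcs !inE => y_e.
  apply/flattenP => -[_ /mapP[v _ ->]]; rewrite /vertex_arcs !inE.
  by case/orP: y_e => /eqP ->; rewrite /eq_op /= ?andbF.
- apply: (@uniq_flatten_map _ _ _ (fun e => match e with
    | (inl (inl (inr u)), inl (inl (inl v)))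
    | (inl (inl (inl v)), inl (inr u)) => Some (u, v)
    | _ => None end)) => //.
  move=> [u v] e.
  by rewrite /link_arcs !inE => /orP[] /eqP ->.
Qed.

Lemma perm_cut_vertices (vs : seq V) :
  perm_eq vs (enum V) -> perm_eq (cut_vertices vs) (enum {: node}).
Proof.
move=> vsE.
have vs_uniq : uniq vs by rewrite (perm_uniq vsE) enum_uniq.
have vsT v : v \in vs by rewrite (perm_mem vsE) mem_enum.
apply: uniq_perm; first 1 last; first exact: enum_uniq.
  by move=> [[[v|v]|v]|[|]]; rewrite mem_enum inE !mem_cat !inE ?map_f ?orbT.
have vert_inj : injective vert by move=> u v [].
have out_inj : injective fan_out by move=> u v [].
have in_inj : injective fan_in by move=> u v [].
rewrite !cat_uniq !map_inj_uniq ?vs_uniq //= !andbT !has_cat /=.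
rewrite !negb_or /= -!all_predC !andbT.
rewrite ?andbA; do ?[apply/andP; split]; rewrite ?mem_map_notin //.
all: by apply/allP => _ /mapP[v _ ->] /=; rewrite mem_map_notin.
Qed.

Lemma index_src (vs : seq V) : index src (cut_vertices vs) = (3 * size vs)%N.
Proof.
by rewrite /cut_vertices !index_cat !size_map !mem_map_notin //= eqxx.
Qed.

Lemma index_snk (vs : seq V) :
  index snk (cut_vertices vs) = (3 * size vs + 1)%N.
Proof.
rewrite /cut_vertices !index_cat !size_map !mem_map_notin //=.
by rewrite /eq_op /=; lia.
Qed.

Lemma index_vert (vs : seq V) v :
  v \in vs -> index (vert v) (cut_vertices vs) = index v vs.
Proof.
have inj_vert : injective vert by move=> ? ? [].
by move=> v_vs; rewrite /cut_vertices index_cat mem_map // v_vs index_map.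
Qed.

Lemma index_fan_out (vs : seq V) v :
  v \in vs -> index (fan_out v) (cut_vertices vs) = (size vs + index v vs)%N.
Proof.
have inj_out : injective fan_out by move=> ? ? [].
move=> v_vs; rewrite /cut_vertices !index_cat mem_map_notin // size_map.
by rewrite mem_map // v_vs index_map.
Qed.

Lemma index_fan_in (vs : seq V) v :
  v \in vs ->
  index (fan_in v) (cut_vertices vs) = (2 * size vs + index v vs)%N.
Proof.
have inj_in : injective fan_in by move=> ? ? [].
move=> v_vs; rewrite /cut_vertices !index_cat 2?mem_map_notin // !size_map.
by rewrite mem_map // v_vs index_map // addnA mul2n addnn.
Qed.

(** * Costs of cuts and costs of assignments *)

Variables (R : realType) (A : {set V * V}) (p : V -> 'I_2 -> R) (q : V -> R).
Hypothesis p_ge0 : forall v i, 0 <= p v i.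
Hypothesis q_ge0 : forall v, 0 <= q v.

(** An arc of the cut graph has at most one fan as an end, and the owner of that fan determines the
    weight. Pairs matching no other pattern get 0. *)
Definition cut_weight (e : node * node) : R :=
  match e with
  | (inr _, inl (inl (inl v))) => p v ord_max
  | (inl (inl (inl v)), inr _) => p v ord0
  | (inl (inl (inr v)), _) | (_, inl (inl (inr v)))
  | (inl (inr v), _) | (_, inl (inr v)) => q v
  | _ => 0
  end.

Lemma cut_weight_ge0 e : 0 <= cut_weight e.
Proof.
by case: e => [[[[u|u]|u]|c] [[[v|v]|v]|d]] /=; rewrite ?p_ge0 ?q_ge0.
Qed.

Definition machine (x : bool) : 'I_2 := if x then ord0 else ord_max.

Definition separated (sigma : V -> bool) (v : V) : bool :=
  [exists u, ((v, u) \in A) && (sigma u != sigma v)].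

(** The part of a cut charged to [v] for data transfer; link arcs are charged to the tail of the arc
    they come from. *)
Definition vertex_cut (sigma : node -> bool) (v : V) : R :=
  q v * (sigma (vert v) && ~~ sigma (fan_out v))%:R +
  q v * (sigma (fan_in v) && ~~ sigma (vert v))%:R +
  \sum_(u | (v, u) \in A)
    (q v * (sigma (fan_out v) && ~~ sigma (vert u))%:R +
     q v * (sigma (vert u) && ~~ sigma (fan_in v))%:R).

(** As the terminals are on their own sides, exactly one of [src -> v] and [v -> snk] is cut, which
    pays the execution cost of [v]. The remaining arcs are grouped by owner. *)
Lemma cut_cost (vs : seq V) (es : seq (V * V)) (sigma : node -> bool) :
    perm_eq vs (enum V) -> perm_eq es (enum A) -> sigma src -> ~~ sigma snk ->
  \sum_(e in [set e in cut_arcs vs es] | sigma e.1 && ~~ sigma e.2)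
    cut_weight e =
  \sum_v (p v (machine (sigma (vert v))) + vertex_cut sigma v).
Proof.
move=> vsE esE src_s snk_s.
have uniq_arcs : uniq (cut_arcs vs es).
  by apply: uniq_cut_arcs; rewrite ?(perm_uniq vsE) ?(perm_uniq esE) enum_uniq.
transitivity (\sum_(e <- cut_arcs vs es)
    cut_weight e * (sigma e.1 && ~~ sigma e.2)%:R).
  rewrite big_mkcondr big_uniq //=; apply: eq_big => e; first by rewrite inE.
  by move=> _; case: ifP; rewrite ?mulr1 ?mulr0.
rewrite big_cat !sum_flatten_map /= (perm_big _ vsE) (perm_big _ esE) /=.
rewrite !big_enum.
have by_tail (F : V * V -> R) :
    \sum_(e in A) F e = \sum_v \sum_(u | (v, u) \in A) F (v, u).
  by rewrite pair_big_dep; apply: eq_big => -[].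
rewrite by_tail -big_split /=.
apply: eq_bigr => v _; rewrite !big_cons big_nil /= src_s snk_s /= andbT addr0.
rewrite /vertex_cut !addrA; congr (_ + _ + _ + _).
  by case: (sigma (vert v)); rewrite /= ?mulr1 ?mulr0 ?addr0 ?add0r.
by apply: eq_bigr => u _; rewrite !big_cons big_nil addr0.
Qed.

(** For a separating out-neighbour [u], either the path [v -> fan_out v -> u] or the path
    [u -> fan_in v -> v] leads from the source side to the sink side, so one of its arcs is cut. All
    other terms are nonnegative. *)
Lemma vertex_cut_ge (sigma : node -> bool) v :
  q v * (separated (sigma \o vert) v)%:R <= vertex_cut sigma v.
Proof.
have term_ge0 (c : bool) : 0 <= q v * c%:R by rewrite mulr_ge0 ?ler0n.
have sum_ge0 (P : pred V) : 0 <= \sum_(u | P u)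
    (q v * (sigma (fan_out v) && ~~ sigma (vert u))%:R +
     q v * (sigma (vert u) && ~~ sigma (fan_in v))%:R).
  by apply: sumr_ge0 => u _; rewrite addr_ge0.
rewrite /vertex_cut /separated.
case: existsP => [[u /andP[vu /= sep_u]]|_]; last first.
  by rewrite mulr0 !addr_ge0.
rewrite (bigD1 u) //= addrA; apply: ler_wpDr => //.
rewrite -!mulrDr ler_wpM2l // -!natrD ler_nat.
move: sep_u; case: (sigma (vert u)); case: (sigma (vert v)) => //= _;
  by case: (sigma (fan_out v)); case: (sigma (fan_in v)).
Qed.

(** The fans of [v] stay with [v] unless it is separated; then [fan_out v] goes to the sink side and
    [fan_in v] to the source side. *)
Definition induced_side (sigma : V -> bool) (x : node) : bool :=
  match x with
  | inl (inl (inl v)) => sigma v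
  | inl (inl (inr v)) => sigma v && ~~ separated sigma v
  | inl (inr v) => sigma v || separated sigma v
  | inr c => c
  end.

(** No link arc is cut. If [v] is separated, exactly one of its fans is on the other side, and the
    arc to or from it is the only one cut. *)
Lemma vertex_cut_induced (sigma : V -> bool) v :
  vertex_cut (induced_side sigma) v = q v * (separated sigma v)%:R.
Proof.
rewrite /vertex_cut /= big1 => [|u vu].
  rewrite addr0 -mulrDr -natrD; congr (_ * _%:R).
  by case: (sigma v); case: (separated sigma v).
have sep : sigma u != sigma v -> separated sigma v.
  by move=> neq_uv; apply/existsP; exists u; rewrite vu.
move: sep; case: (sigma u); case: (sigma v); case: (separated sigma v) => //=;
  rewrite ?mulr0 ?addr0 // => /(_ isT) //.
Qed.

Lemma tr_separated (f : V -> 'I_2) :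
  tr A f q = \sum_v q v * (separated (fun v => f v == ord0) v)%:R.
Proof.
rewrite /tr (exchange_big_dep xpredT) //=; apply: eq_bigr => v _.
rewrite (big_pred1 (f v)) => [|i]; last by rewrite !inE eq_sym.
(* With two machines this is the only [j] other than [f v]. *)
rewrite (big_pred1 (machine (f v != ord0))) => [|j]; last first.
  by case: (f v) j => [[|[|?]] ?] [[|[|?]] ?].
congr (q v * _%:R); rewrite /meets_out; congr nat_of_bool.
apply/set0Pn/existsP => -[u].
  rewrite !inE => /andP[vu /eqP fu]; exists u; rewrite vu fu /=.
  by case: (f v) => [[|[|?]] ?].
move=> /andP[vu neq]; exists u; rewrite !inE vu /=.
by move: neq; case: (f v) (f u) => [[|[|?]] ?] [[|[|?]] ?].
Qed.

Lemma sum_machine_tr (f : V -> 'I_2) (sigma : V -> bool) :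
    (forall v, f v = machine (sigma v)) ->
  \sum_v p v (f v) + tr A f q =
  \sum_v (p v (machine (sigma v)) + q v * (separated sigma v)%:R).
Proof.
move=> fE; rewrite tr_separated -big_split /=; apply: eq_bigr => v _.
have sigmaE u : (f u == ord0) = sigma u by rewrite fE; case: (sigma u).
rewrite fE /separated; congr (_ + _ * (nat_of_bool _)%:R).
by apply: eq_existsb => u; rewrite !sigmaE.
Qed.

(** An assignment costs as much as its induced cut; conversely, restricting a cut to the original
    vertices gives an assignment that costs no more. *)
Lemma assignment_cut (vs : seq V) (es : seq (V * V)) (r : R) :
    perm_eq vs (enum V) -> perm_eq es (enum A) ->
  (exists f : V -> 'I_2, \sum_v p v (f v) + tr A f q <= r) <->
  (exists Vs Vt : {set node},
    [/\ Vs :|: Vt = [set: node], [disjoint Vs & Vt], src \in Vs, snk \in Vt &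
        \sum_(e in [set e in cut_arcs vs es] | (e.1 \in Vs) && (e.2 \in Vt))
          cut_weight e <= r]).
Proof.
move=> vsE esE; split=> [[f le_f]|[Vs [Vt [VsUVt dis src_s snk_t le_c]]]].
  pose sigma v := f v == ord0.
  have fE v : f v = machine (sigma v).
    by apply: val_inj; rewrite /sigma; case: (f v) => [[|[|?]] ?].
  exists [set x | induced_side sigma x], (~: [set x | induced_side sigma x]).
  split; rewrite ?setUCr ?inE // -?setI_eq0 ?setICr //.
  rewrite (eq_bigl (fun e => (e \in [set e in cut_arcs vs es]) &&
    (induced_side sigma e.1 && ~~ induced_side sigma e.2))) => [|e].
    rewrite cut_cost //; rewrite (sum_machine_tr fE) in le_f.
    by under eq_bigr do rewrite vertex_cut_induced.
  by rewrite !inE.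
have VtE x : (x \in Vt) = (x \notin Vs).
  have := in_setT x; rewrite -VsUVt inE.
  by move: (disjointFr dis (x := x)); case: (x \in Vs) => [->|_ /= ->].
exists (fun v => machine (vert v \in Vs)).
rewrite (@sum_machine_tr _ (fun v => vert v \in Vs)) //; apply: le_trans le_c.
under [leRHS]eq_bigl do rewrite VtE.
rewrite (@cut_cost _ _ (fun x => x \in Vs) vsE esE src_s) -?VtE //.
by apply: ler_sum => v _; rewrite lerD2l; apply: vertex_cut_ge.
Qed.

(** * The output of the program encodes the cut graph *)

Lemma size_cut_vertices (vs : seq V) :
  size (cut_vertices vs) = (3 * size vs + 2)%N.
Proof. by rewrite !size_cat !size_map /=; lia. Qed.

Lemma size_cut_arcs (vs : seq V) (es : seq (V * V)) :
  size (cut_arcs vs es) = (4 * size vs + 2 * size es)%N.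
Proof.
by rewrite size_cat (@size_flatten_map _ _ _ 4) // (@size_flatten_map _ _ _ 2).
Qed.

Definition arc_indices (vs : seq V) (e : V * V) : nat * nat :=
  (index e.1 vs, index e.2 vs).

Lemma input_words_digraph (vs : seq V) (es : seq (V * V)) :
  digraph_words vs es = input_words (size vs) (map (arc_indices vs) es).
Proof. by rewrite /digraph_words /input_words size_map -map_comp. Qed.

Lemma output_words_cut (vs : seq V) (es : seq (V * V)) :
    perm_eq vs (enum V) ->
  digraph_words (cut_vertices vs) (cut_arcs vs es) ++
    [:: index src (cut_vertices vs); index snk (cut_vertices vs)] =
  output_words (size vs) (map (arc_indices vs) es).
Proof.
move=> vsE; have vsT v : v \in vs by rewrite (perm_mem vsE) mem_enum.
rewrite /digraph_words /output_words size_cut_vertices size_cut_arcs size_map.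
rewrite index_src index_snk /=; congr [:: _, _ & _].
(* The program counts through [iota]; read as positions in [vs], these numbers let both sides be
   compared vertex by vertex. *)
rewrite map_cat flatten_cat -catA -map_index; last first.
  by rewrite (perm_uniq vsE) enum_uniq.
rewrite !map_flatten_map !flatten_flatten -!map_comp.
congr (flatten _ ++ flatten _ ++ _); apply: eq_map => x /=.
  by rewrite index_src index_snk index_vert // index_fan_out // index_fan_in.
by rewrite !index_vert // index_fan_out // index_fan_in.
Qed.

Lemma output_reals_cut (vs : seq V) (es : seq (V * V)) (r : R) :
    perm_eq vs (enum V) ->
  let rs := [seq p v i | v <- vs, i <- enum 'I_2] ++ map q vs ++ [:: r] in
  size rs = (3 * size vs + 1)%N /\
  map cut_weight (cut_arcs vs es) ++ [:: r] =
  output_reals rs (size vs) (map (arc_indices vs) es).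
Proof.
move=> vsE rs; have vsT v : v \in vs by rewrite (perm_mem vsE) mem_enum.
have enum2 : enum 'I_2 = [:: ord0; ord_max].
  by apply: (inj_map val_inj); rewrite val_enum_ord.
have rsE : rs = flatten [seq [:: p v ord0; p v ord_max] | v <- vs]
    ++ map q vs ++ [:: r].
  by rewrite /rs enum2.
have sz_p : size (flatten [seq [:: p v ord0; p v ord_max] | v <- vs]) =
    (2 * size vs)%N by exact: size_flatten_map.
have nth_q v : nth 0 rs (2 * size vs + index v vs) = q v.
  rewrite rsE nth_cat sz_p ltnNge leq_addr /= addKn nth_cat size_map index_mem.
  by rewrite vsT (nth_map v) ?index_mem // nth_index.
split; first by rewrite rsE !size_cat sz_p size_map /=; lia.
rewrite /output_reals -map_index; last by rewrite (perm_uniq vsE) enum_uniq.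
rewrite map_cat -catA !map_flatten_map -!map_comp.
congr (flatten _ ++ flatten _ ++ [:: _]).
- apply: eq_map => v /=; rewrite /vertex_reals nth_q.
  have [p0 p1] := nth_flatten_pairs (p ^~ ord0) (p ^~ ord_max)
    (map q vs ++ [:: r]) 0 (vsT v).
  by rewrite rsE p0 p1.
- by apply: eq_map => e /=; rewrite /arc_reals /= nth_q.
(* The bound [r] comes after the [2 * size vs] values of [p] and the [size vs] values of [q]. *)
- rewrite rsE nth_cat sz_p ltnNge leq_mul2r orbT /= -mulnBl mul1n.
  by rewrite nth_cat size_map ltnn subnn.
Qed.

End CutGraph.

(** * The reduction *)

Theorem theorem2 (R : realType) :
  linear_time_reducible (ESP_DAG R 2) (DM_st_Cut R).
Proof.
(* The factor 40 covers the running time, at most 34 steps per vertex and 21 per arc plus a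
   constant, and also the word size. *)
exists reduction_prog, 40%N => I ws rs [vs [es [vsE esE -> ->]]].
have vs_v v : v \in vs by rewrite (perm_mem vsE) mem_enum.
pose J := @CutInstance R _ [set e in cut_arcs vs es]
  (cut_weight (@esp_p _ _ I) (@esp_q _ _ I)) (src _) (snk _) (ratr (esp_r I))
  (fun e _ => cut_weight_ge0 (@esp_p_ge0 _ _ I) (@esp_q_ge0 _ _ I) e) isT.
have [sz_rs rs'E] := output_reals_cut (@esp_p _ _ I) (@esp_q _ _ I) es
  (ratr (esp_r I)) vsE.
exists J, (output_words (size vs) (map (arc_indices vs) es)),
  (map (@cut_w _ J) (cut_arcs vs es) ++ [:: ratr (esp_r I)]).
split.
- exists (cut_vertices vs), (cut_arcs vs es); split => //.
  + exact: perm_cut_vertices.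
  + apply: uniq_perm; rewrite ?enum_uniq //.
      by rewrite uniq_cut_arcs ?(perm_uniq vsE) ?(perm_uniq esE) ?enum_uniq.
    by move=> e; rewrite mem_enum inE.
  + by rewrite output_words_cut.
- by apply: assignment_cut => //; apply: esp_q_ge0.
- move=> b le_b; rewrite [X in computes_within _ _ _ _ _ _ X]rs'E.
  rewrite input_words_digraph; apply: reduction_prog_computes => //.
  + by apply/allP => _ /mapP[e _ ->]; rewrite /= index_mem.
  + by rewrite -input_words_digraph.
Qed.
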